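(* Let $A$ be the $\mathbb{K}$-algebra presented by the relations (N1)–(N12) of the context. Let $0\le i\le 6$, $0\le j\le 3$, and let $U,V$ be (possibly empty) words in the letters $a_0,a_1,a_2,a_3$. Then the word $tRUQ_iP_jVR$ is nilpotent in $A$ if and only if the Turing machine started in the full state $M(i,j,U,V)$ halts.
   Context: **Machine.** States $0,\dots,6$, tape colours $0,\dots,3$ (colour $0$ is blank). Instructions $(i,j)\to(D,q(i,j),p(i,j))$: in state $i$ on a cell of colour $j$, recolour the cell to $p(i,j)$, move the head one cell in direction $D$ ($L$ = left, $R$ = right), and change to state $q(i,j)$. The table is: $(0,0)\to(L,4,1)$, $(0,1)\to(L,1,3)$, $(0,2)\to(R,0,0)$, $(0,3)\to(R,0,1)$; $(1,0)\to(L,1,2)$, $(1,1)\to(L,1,3)$, $(1,2)\to(R,0,0)$, $(1,3)\to(L,1,3)$; $(2,0)\to(R,2,2)$, $(2,1)\to(R,2,1)$, $(2,2)\to(R,2,0)$, $(2,3)\to(L,4,1)$; $(3,0)\to(R,3,2)$, $(3,1)\to(R,3,1)$, $(3,2)\to(R,3,0)$, $(3,3)\to(L,4,0)$; $(4,0)\to(L,5,2)$, $(4,1)\to(L,4,1)$, $(4,2)\to(L,4,0)$, $(4,3)\to$ STOP; $(5,0)\to(L,5,2)$, $(5,1)\to(L,5,1)$, $(5,2)\to(L,6,2)$, $(5,3)\to(R,2,1)$; $(6,0)\to(R,0,3)$, $(6,1)\to(R,6,3)$, $(6,2)\to(R,6,2)$, $(6,3)\to(R,3,1)$. A pair $(i,j)\ne(4,3)$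 is a left (right) pair if its direction is $L$ ($R$). **Full states.** $M(i,j,U,V)$, with $U=a_{u_1}\cdots a_{u_k}$, $V=a_{v_1}\cdots a_{v_l}$, is the configuration in state $i$, current cell of colour $j$, cells to the left of the head coloured $u_1,\dots,u_k$ (left to right), cells to the right coloured $v_1,\dots,v_l$, and all other cells blank. Its next state $M(i',j',U',V')$, for $(i,j)\neq(4,3)$, is given by $i'=q(i,j)$ and: for a left pair, $V'=a_{p(i,j)}V$, and if $U=\tilde Ua_k$ then $j'=k$, $U'=\tilde U$, while if $U$ is empty then $j'=0$, $U'$ is empty; for a right pair, $U'=Ua_{p(i,j)}$, and if $V=a_k\tilde V$ then $j'=k$, $V'=\tilde V$, while if $V$ is empty then $j'=0$, $V'$ is empty. The machine halts when it reaches a full state with $(i,j)=(4,3)$. **Algebra $A$.** $A$ is the associative algebra over a field $\mathbb{K}$ with generators $\Phi=\{t,a_0,\dots,a_3,Q_0,\dots,Q_6,P_0,\dots,P_3,R\}$ and relations (indices $k,l,n$ range over $0,\dots,3$; write $q=q(i,j)$, $p=p(i,j)$): (N1) $tRa_l=Rta_l$; (N2) $ta_lR=a_lRt$; (N3) $ta_ka_l=a_kta_l$; (N4) $ta_kQ_iP_j=Q_{q}P_kta_{p}$ for left pairs $(i,j)$; (N5) $tRQ_iP_j=RQ_{q}P_0ta_{p}$ for left pairs $(i,j)$; (N6) $ta_lQ_iP_ja_ka_n=a_la_{p}Q_{q}P_kta_n$ for right pairs $(i,j)$; (N7) $ta_lQ_iP_ja_kR=a_la_{p}Q_{q}P_kRt$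 for right pairs $(i,j)$; (N8) $tRQ_iP_ja_ka_n=Ra_{p}Q_{q}P_kta_n$ for right pairs $(i,j)$; (N9) $tRQ_iP_ja_kR=Ra_{p}Q_{q}P_kRt$ for right pairs $(i,j)$; (N10) $ta_lQ_iP_jR=a_la_{p}Q_{q}P_0Rt$ for right pairs $(i,j)$; (N11) $tRQ_iP_jR=Ra_{p}Q_{q}P_0Rt$ for right pairs $(i,j)$; (N12) $Q_4P_3=0$. *)

(* Defs.v *)
From HB Require Import structures.
From mathcomp Require Import all_boot all_order all_algebra.
From mathcomp Require Import generic_quotient ring_quotient.
From mathcomp Require Import monalg.
From mathcomp Require boolp.

Set Implicit Arguments.
Unset Strict Implicit.
Unset Printing Implicit Defensive.

Import GRing.Theory.
Local Open Scope ring_scope.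
Local Open Scope quotient_scope.

Notation state := 'I_7.
Notation colour := 'I_4.

Variant direction := Left | Right.

Local Notation act D q p :=
  (Some (D, @Ordinal 7 q isT, @Ordinal 4 p isT)) (only parsing).

(* [None] is STOP; the final clause is never reached on 'I_7 and 'I_4. *)
Definition instr (i : state) (j : colour) : option (direction * state * colour) :=
  match i : nat, j : nat with
  | 0, 0 => act Left 4 1
  | 0, 1 => act Left 1 3
  | 0, 2 => act Right 0 0
  | 0, 3 => act Right 0 1
  | 1, 0 => act Left 1 2
  | 1, 1 => act Left 1 3
  | 1, 2 => act Right 0 0
  | 1, 3 => act Left 1 3
  | 2, 0 => act Right 2 2
  | 2, 1 => act Right 2 1
  | 2, 2 => act Right 2 0
  | 2, 3 => act Left 4 1
  | 3, 0 => act Right 3 2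
  | 3, 1 => act Right 3 1
  | 3, 2 => act Right 3 0
  | 3, 3 => act Left 4 0
  | 4, 0 => act Left 5 2
  | 4, 1 => act Left 4 1
  | 4, 2 => act Left 4 0
  | 4, 3 => None
  | 5, 0 => act Left 5 2
  | 5, 1 => act Left 5 1
  | 5, 2 => act Left 6 2
  | 5, 3 => act Right 2 1
  | 6, 0 => act Right 0 3
  | 6, 1 => act Right 6 3
  | 6, 2 => act Right 6 2
  | 6, 3 => act Right 3 1
  | _, _ => None
  end%N.

(* [M i j U V]: both [U] and [V] are listed from left to right, so that the
   cell next to the head is the last one of [U] and the first one of [V]. *)
Inductive full_state := M of state & colour & seq colour & seq colour.

Inductive next_state : full_state -> full_state -> Prop :=
| NextLeft i j q p k U V : instr i j = Some (Left, q, p) ->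
    next_state (M i j (rcons U k) V) (M q k U (p :: V))
| NextLeft0 i j q p V : instr i j = Some (Left, q, p) ->
    next_state (M i j [::] V) (M q ord0 [::] (p :: V))
| NextRight i j q p k U V : instr i j = Some (Right, q, p) ->
    next_state (M i j U (k :: V)) (M q k (rcons U p) V)
| NextRight0 i j q p U : instr i j = Some (Right, q, p) ->
    next_state (M i j U [::]) (M q ord0 (rcons U p) [::]).

Inductive halts : full_state -> Prop :=
| HaltsNow U V : halts (M (@Ordinal 7 4 isT) (@Ordinal 4 3 isT) U V)
| HaltsNext s s' : next_state s s' -> halts s' -> halts s.

Inductive ideal_gen (F : pzRingType) (S : F -> Prop) : F -> Prop :=
| IdealGen x : S x -> ideal_gen S x
| Ideal0 : ideal_gen S 0
| IdealB x y : ideal_gen S x -> ideal_gen S y -> ideal_gen S (x - y)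
| IdealMl u x : ideal_gen S x -> ideal_gen S (u * x)
| IdealMr x v : ideal_gen S x -> ideal_gen S (x * v).

Definition nilpotent (F : pzRingType) (x : F) : Prop :=
  exists n : nat, (0 < n)%N /\ x ^+ n = 0.

Inductive gen := t_ | a_ of colour | Q_ of state | P_ of colour | R_.

Definition gen_code (g : gen) : unit + colour + state + colour + unit :=
  match g with
  | t_ => inl (inl (inl (inl tt)))
  | a_ k => inl (inl (inl (inr k)))
  | Q_ i => inl (inl (inr i))
  | P_ j => inl (inr j)
  | R_ => inr tt
  end.

Definition gen_decode (c : unit + colour + state + colour + unit) : gen :=
  match c with
  | inl (inl (inl (inl _))) => t_
  | inl (inl (inl (inr k))) => a_ k
  | inl (inl (inr i)) => Q_ i
  | inl (inr j) => P_ j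
  | inr _ => R_
  end.

Lemma gen_codeK : cancel gen_code gen_decode.
Proof. by case. Qed.

HB.instance Definition _ := Finite.copy gen (can_type gen_codeK).

(* {fmonom gen} is the free monoid on gen, so this is the free associative
   K-algebra on gen. *)
Notation free_alg K := {malg K[{fmonom gen}]}.

Lemma malg_scalerAr (G : monomType) (K : fieldType) (c : K)
    (x y : {malg K[G]}) : c *: (x * y) = x * (c *: y).
Proof.
rewrite -2!mul_malgC 2!mulrA; congr (_ * y).
rewrite 2!malgM_def fgmulUg fgmulgU; apply: eq_bigr => k _.
by rewrite mul1m mulm1 mulrC.
Qed.

Section Presentation.
Variable K : fieldType.
Local Notation F := (free_alg K).

Definition fgen (g : gen) : F := << fmu g >>.
Definition fword (w : seq gen) : F := \prod_(g <- w) fgen g.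

(* An equation [u = v] between words is encoded as the relator [u - v]. *)
Inductive relator : F -> Prop :=
| N1 l : relator (fword [:: t_; R_; a_ l] - fword [:: R_; t_; a_ l])
| N2 l : relator (fword [:: t_; a_ l; R_] - fword [:: a_ l; R_; t_])
| N3 k l : relator (fword [:: t_; a_ k; a_ l] - fword [:: a_ k; t_; a_ l])
| N4 k i j q p : instr i j = Some (Left, q, p) ->
    relator (fword [:: t_; a_ k; Q_ i; P_ j]
           - fword [:: Q_ q; P_ k; t_; a_ p])
| N5 i j q p : instr i j = Some (Left, q, p) ->
    relator (fword [:: t_; R_; Q_ i; P_ j]
           - fword [:: R_; Q_ q; P_ ord0; t_; a_ p])
| N6 l k n i j q p : instr i j = Some (Right, q, p) ->
    relator (fword [:: t_; a_ l; Q_ i; P_ j; a_ k; a_ n]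
           - fword [:: a_ l; a_ p; Q_ q; P_ k; t_; a_ n])
| N7 l k i j q p : instr i j = Some (Right, q, p) ->
    relator (fword [:: t_; a_ l; Q_ i; P_ j; a_ k; R_]
           - fword [:: a_ l; a_ p; Q_ q; P_ k; R_; t_])
| N8 k n i j q p : instr i j = Some (Right, q, p) ->
    relator (fword [:: t_; R_; Q_ i; P_ j; a_ k; a_ n]
           - fword [:: R_; a_ p; Q_ q; P_ k; t_; a_ n])
| N9 k i j q p : instr i j = Some (Right, q, p) ->
    relator (fword [:: t_; R_; Q_ i; P_ j; a_ k; R_]
           - fword [:: R_; a_ p; Q_ q; P_ k; R_; t_])
| N10 l i j q p : instr i j = Some (Right, q, p) ->
    relator (fword [:: t_; a_ l; Q_ i; P_ j; R_]
           - fword [:: a_ l; a_ p; Q_ q; P_ ord0; R_; t_])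
| N11 i j q p : instr i j = Some (Right, q, p) ->
    relator (fword [:: t_; R_; Q_ i; P_ j; R_]
           - fword [:: R_; a_ p; Q_ q; P_ ord0; R_; t_])
| N12 : relator (fword [:: Q_ (@Ordinal 7 4 isT); P_ (@Ordinal 4 3 isT)]).

Definition rel_ideal : {pred F} := fun x => boolp.asbool (ideal_gen relator x).

Lemma rel_idealP x : reflect (ideal_gen relator x) (x \in rel_ideal).
Proof. exact: boolp.asboolP. Qed.

Lemma rel_ideal_zmod_closed : zmod_closed rel_ideal.
Proof.
split; first exact/rel_idealP/Ideal0.
by move=> x y /rel_idealP Ix /rel_idealP Iy; apply/rel_idealP/IdealB.
Qed.

HB.instance Definition _ :=
  GRing.isZmodClosed.Build F rel_ideal rel_ideal_zmod_closed.

Lemma rel_idealMl u x : x \in rel_ideal -> u * x \in rel_ideal.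
Proof. by move=> /rel_idealP Ix; apply/rel_idealP/IdealMl. Qed.

Lemma rel_idealMr x v : x \in rel_ideal -> x * v \in rel_ideal.
Proof. by move=> /rel_idealP Ix; apply/rel_idealP/IdealMr. Qed.

Lemma rel_idealZ (c : K) x : x \in rel_ideal -> c *: x \in rel_ideal.
Proof. by move=> Ix; rewrite -[x]mul1r scalerAl rel_idealMl. Qed.

Lemma mcoeff1_fword g w : (fword (g :: w))@_(mone) = 0.
Proof.
rewrite /fword big_cons rmorphM /= /fgen mcoeffU.
have -> : mone = FMonom [::] :> {fmonom gen} by exact: fmoneE.
by rewrite fmuE; case: eqP => //; rewrite mul0r.
Qed.

Lemma mcoeff1_fwordB g w g' w' : (fword (g :: w) - fword (g' :: w'))@_(mone) = 0.
Proof.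
by rewrite mcoeffB (mcoeff1_fword g) (mcoeff1_fword g') subrr.
Qed.

Lemma mcoeff1_rel_ideal x : x \in rel_ideal -> x@_(mone) = 0.
Proof.
move=> /rel_idealP; elim=> {x} [x||x y _ IHx _ IHy|u x _ IHx|x v _ IHx].
- by case=> *; [apply: mcoeff1_fwordB .. | apply: mcoeff1_fword].
- exact: mcoeff0.
- by rewrite mcoeffB IHx IHy subrr.
- by rewrite rmorphM /= IHx mulr0.
- by rewrite rmorphM /= IHx mul0r.
Qed.

Lemma rel_ideal_proper : 1 \notin rel_ideal.
Proof.
apply/negP => /mcoeff1_rel_ideal /eqP.
by rewrite rmorph1 oner_eq0.
Qed.

Definition algA := Quotient.quot rel_ideal.

HB.instance Definition _ := GRing.Zmodule.on algA.
HB.instance Definition _ := EqQuotient.on algA.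

Definition pi_algA (x : F) : algA := \pi x.

Lemma pi_algA_eq (x y : F) : (pi_algA x == pi_algA y) = (x - y \in rel_ideal).
Proof. by rewrite Quotient.idealrBE. Qed.

Lemma pi_algAP (x y : F) :
  reflect (pi_algA x = pi_algA y) (x - y \in rel_ideal).
Proof. by rewrite -pi_algA_eq; apply: eqP. Qed.

Lemma repr_algA (x : F) : repr (pi_algA x) - x \in rel_ideal.
Proof. by apply/pi_algAP; rewrite /pi_algA reprK. Qed.

Lemma algA_ind (P : algA -> Prop) : (forall x, P (pi_algA x)) -> forall x, P x.
Proof. by move=> Ppi x; rewrite -[x]reprK. Qed.

Lemma pi_algAD (x y : F) : pi_algA (x + y) = pi_algA x + pi_algA y.
Proof. by rewrite /pi_algA Quotient.pi_add. Qed.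

Definition algA_one : algA := pi_algA 1.
Definition algA_mul (x y : algA) : algA := pi_algA (repr x * repr y).
Definition algA_scale (c : K) (x : algA) : algA := pi_algA (c *: repr x).

Lemma pi_algAM (x y : F) : pi_algA (x * y) = algA_mul (pi_algA x) (pi_algA y).
Proof.
apply/esym/pi_algAP; set u := repr _; set v := repr _.
have -> : u * v - x * y = (u - x) * v + x * (v - y).
  by rewrite mulrBl mulrBr addrA subrK.
by apply: rpredD; [apply/rel_idealMr/repr_algA | apply/rel_idealMl/repr_algA].
Qed.

Lemma pi_algAZ (c : K) (x : F) : pi_algA (c *: x) = algA_scale c (pi_algA x).
Proof. by apply/esym/pi_algAP; rewrite -scalerBr rel_idealZ ?repr_algA. Qed.

Lemma algA_mulA : associative algA_mul.
Proof.
by elim/algA_ind=> x; elim/algA_ind=> y; elim/algA_ind=> z;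
  rewrite -!pi_algAM mulrA.
Qed.

Lemma algA_mul1l : left_id algA_one algA_mul.
Proof. by elim/algA_ind=> x; rewrite -pi_algAM mul1r. Qed.

Lemma algA_mul1r : right_id algA_one algA_mul.
Proof. by elim/algA_ind=> x; rewrite -pi_algAM mulr1. Qed.

Lemma algA_mulDl : left_distributive algA_mul +%R.
Proof.
by elim/algA_ind=> x; elim/algA_ind=> y; elim/algA_ind=> z;
  rewrite -!(pi_algAD, pi_algAM) mulrDl.
Qed.

Lemma algA_mulDr : right_distributive algA_mul +%R.
Proof.
by elim/algA_ind=> x; elim/algA_ind=> y; elim/algA_ind=> z;
  rewrite -!(pi_algAD, pi_algAM) mulrDr.
Qed.

Lemma pi_algA0 : pi_algA 0 = 0.
Proof. by apply: (addIr (pi_algA 0)); rewrite -pi_algAD !add0r. Qed.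

Lemma algA_one_neq0 : algA_one != 0.
Proof. by rewrite -pi_algA0 pi_algA_eq subr0 rel_ideal_proper. Qed.

HB.instance Definition _ := GRing.Zmodule_isNzRing.Build algA
  algA_mulA algA_mul1l algA_mul1r algA_mulDl algA_mulDr algA_one_neq0.

Lemma algA_scaleA a b x : algA_scale a (algA_scale b x) = algA_scale (a * b) x.
Proof. by elim/algA_ind: x => x; rewrite -!pi_algAZ scalerA. Qed.

Lemma algA_scale1 : left_id 1 algA_scale.
Proof. by elim/algA_ind=> x; rewrite -!pi_algAZ scale1r. Qed.

Lemma algA_scaleDr : right_distributive algA_scale +%R.
Proof.
by move=> c; elim/algA_ind=> x; elim/algA_ind=> y;
  rewrite -!(pi_algAD, pi_algAZ) scalerDr.
Qed.

Lemma algA_scaleDl x : {morph algA_scale^~ x : a b / a + b}.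
Proof.
by elim/algA_ind: x => x a b; rewrite -!(pi_algAD, pi_algAZ) scalerDl.
Qed.

HB.instance Definition _ := GRing.Zmodule_isLmodule.Build K algA
  algA_scaleA algA_scale1 algA_scaleDr algA_scaleDl.

Fact pi_algA_zmod_morphism : zmod_morphism pi_algA.
Proof.
by move=> x y; apply: (addIr (pi_algA y)); rewrite -pi_algAD !subrK.
Qed.

Fact pi_algA_monoid_morphism : monoid_morphism pi_algA.
Proof. by split; [exact: erefl | exact: pi_algAM]. Qed.

HB.instance Definition _ :=
  GRing.isZmodMorphism.Build F algA pi_algA pi_algA_zmod_morphism.
HB.instance Definition _ :=
  GRing.isMonoidMorphism.Build F algA pi_algA pi_algA_monoid_morphism.
HB.instance Definition _ :=
  GRing.isScalable.Build K F algA *:%R pi_algA pi_algAZ.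

Fact algA_scalerAl (c : K) (x y : algA) : c *: (x * y) = (c *: x) * y.
Proof.
elim/algA_ind: x => x; elim/algA_ind: y => y.
by rewrite -rmorphM -!linearZ /= -rmorphM scalerAl.
Qed.

HB.instance Definition _ := GRing.Lmodule_isLalgebra.Build K algA algA_scalerAl.

Fact algA_scalerAr (c : K) (x y : algA) : c *: (x * y) = x * (c *: y).
Proof.
elim/algA_ind: x => x; elim/algA_ind: y => y.
by rewrite -rmorphM -!linearZ /= -rmorphM malg_scalerAr.
Qed.

HB.instance Definition _ := GRing.Lalgebra_isAlgebra.Build K algA algA_scalerAr.

Definition word (w : seq gen) : algA := \prod_(g <- w) pi_algA (fgen g).

End Presentation.

Arguments pi_algA {K} x.

(* Main.v *)
(** Write [W s] for the word [R U Q_i P_j V R] of the full state [s].  Pushing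
    [t] through it from left to right performs one step of the machine, so
    [t W s = W (next s) t] holds in the algebra, also at STOP, where both sides
    vanish.  Hence [(t W s)^n] is the product of the words of the next [n] full
    states followed by [t^n], and this vanishes once the machine has stopped.

    Conversely, the left-hand sides of (N1)-(N11) have a single [t], in first
    position, and no two of them match at the same place.  Hence the algebra
    acts on the words without [t] together with a dead element: a letter other
    than [t] is prepended (giving the dead element if this creates [Q_4 P_3])
    and [t] is pushed to the end of the word, where it disappears.  A word that
    sends the empty word to a live one is nonzero in the algebra, which applies
    to the product above when no state in it is at STOP. *)
From HB Require Import structures.
Require Import Defs.
From mathcomp Require Import all_boot all_order all_algebra.
From mathcomp Require Import finmap monalg.
From mathcomp Require boolp.

Set Implicit Arguments.
Unset Strict Implicit.
Unset Printing Implicit Defensive.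

Import GRing.Theory.
Local Open Scope ring_scope.

Notation stop_state := (@Ordinal 7 4 isT).
Notation stop_colour := (@Ordinal 4 3 isT).

(** * The machine *)

Definition stopped (s : full_state) : bool :=
  let: M i j _ _ := s in ~~ isSome (instr i j).

(* On an empty [U] or [V], [last] and [head] return the blank colour. *)
Definition next (s : full_state) : full_state :=
  let: M i j U V := s in
  match instr i j with
  | Some (Left, q, p) => M q (last ord0 U) (take (size U).-1 U) (p :: V)
  | Some (Right, q, p) => M q (head ord0 V) (rcons U p) (behead V)
  | None => s
  end.

Lemma take_pred_rcons (T : Type) (s : seq T) x :
  take (size (rcons s x)).-1 (rcons s x) = s.
Proof. by rewrite size_rcons -cats1 take_size_cat. Qed.

Lemma instr_None i j :
  instr i j = None -> i = stop_state /\ j = stop_colour.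
Proof.
by case: i => [[|[|[|[|[|[|[|i]]]]]]] ltim //];
   case: j => [[|[|[|[|j]]]] ltjm //] //= _; split; apply: val_inj.
Qed.

Lemma next_stateE s s' : next_state s s' -> next s = s'.
Proof.
by case=> [i j q p k U V|i j q p V|i j q p k U V|i j q p U] E /=;
   rewrite E ?last_rcons ?take_pred_rcons.
Qed.

Lemma next_state_next s : ~~ stopped s -> next_state s (next s).
Proof.
case: s => i j U V /=; case E: (instr i j) => [[[[] q] p]|] //= _.
  case/lastP: U => [|U k]; first exact: NextLeft0.
  by rewrite last_rcons take_pred_rcons; apply: NextLeft.
by case: V => [|k V]; [apply: NextRight0 | apply: NextRight].
Qed.

Lemma halts_stopped s : stopped s -> halts s.
Proof.
case: s => i j U V /=; case E: (instr i j) => // _.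
by have [-> ->] := instr_None E; apply: HaltsNow.
Qed.

Lemma halts_next s : halts (next s) -> halts s.
Proof.
have [/halts_stopped //|run_s] := boolP (stopped s).
exact: HaltsNext (next_state_next run_s).
Qed.

Lemma haltsP s : halts s <-> exists n, stopped (iter n next s).
Proof.
split=> [|[n]].
  elim=> [U V|{}s s' /next_stateE <- _ [n stop_n]]; first by exists 0%N.
  by exists n.+1; rewrite iterSr.
elim: n s => [|n IHn] s; first exact: halts_stopped.
by rewrite iterSr => /IHn /halts_next.
Qed.

(** A state at STOP is a fixed point of [next], so runs may be prolonged past the stop. *)
Lemma stopped_next s : stopped s -> stopped (next s).
Proof. by case: s => i j U V /=; case E: (instr i j) => //=; rewrite E. Qed.

(** * Words in the algebra *)

Definition state_word (s : full_state) : seq gen :=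
  let: M i j U V := s in
  R_ :: map a_ U ++ [:: Q_ i, P_ j & map a_ V ++ [:: R_]].

Fixpoint run_word (s : full_state) (n : nat) : seq gen :=
  if n is m.+1 then state_word s ++ run_word (next s) m else [::].

Section Algebra.
Variable K : fieldType.
Implicit Types u v w x y : seq gen.

Lemma pi_fword w : pi_algA (fword K w) = word K w.
Proof. by rewrite /fword rmorph_prod. Qed.

Lemma word_cat u v : word K (u ++ v) = word K u * word K v.
Proof. exact: big_cat. Qed.

Lemma word_cons g w : word K (g :: w) = pi_algA (fgen K g) * word K w.
Proof. exact: big_cons. Qed.

Lemma word_relator x y u v : relator (fword K x - fword K y) ->
  word K (u ++ x ++ v) = word K (u ++ y ++ v).
Proof.
move=> rel_xy; rewrite !word_cat -(pi_fword x) -(pi_fword y).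
by congr (_ * (_ * _)); apply/pi_algAP/rel_idealP/IdealGen.
Qed.

(** (N1) and then (N3) carry [t_] inwards. It halts in front of the letter next to the head, where
    the rules for a move apply. *)
Lemma word_slide_left U k w :
  word K [:: t_, R_ & map a_ (rcons U k) ++ w]
  = word K (R_ :: map a_ U ++ [:: t_, a_ k & w]).
Proof.
case: U => [|c U] /=; first exact: (@word_relator _ _ [::] _ (N1 K _)).
rewrite (@word_relator _ _ [::] _ (N1 K _)) /= !(word_cons R_); congr (_ * _).
elim: U c => [|d U IHU] c /=.
  exact: (@word_relator _ _ [::] _ (N3 K _ _)).
rewrite (@word_relator _ _ [::] _ (N3 K _ _)) /=.
by rewrite !(word_cons (a_ c)); congr (_ * _); apply: IHU.
Qed.

Lemma word_slide_right k V :
  word K [:: t_, a_ k & map a_ V ++ [:: R_]]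
  = word K (a_ k :: map a_ V ++ [:: R_; t_]).
Proof.
elim: V k => [|l V IHV] k /=.
  exact: (@word_relator _ _ [::] [::] (N2 K _)).
rewrite (@word_relator _ _ [::] _ (N3 K _ _)) /=.
by rewrite !(word_cons (a_ k)); congr (_ * _); apply: IHV.
Qed.

Lemma word_stopped s : stopped s -> word K (state_word s) = 0.
Proof.
case: s => i j U V /=; case E: (instr i j) => // _.
have [-> ->] := instr_None E.
have Q4P3_0 : word K [:: Q_ stop_state; P_ stop_colour] = 0.
  rewrite -pi_fword -(pi_algA0 K); apply/pi_algAP.
  by rewrite subr0; apply/rel_idealP/IdealGen/N12.
by rewrite word_cons word_cat (word_cat [:: Q_ _; P_ _]) Q4P3_0 mul0r !mulr0.
Qed.

Lemma word_next s :
  word K (t_ :: state_word s) = word K (state_word (next s) ++ [:: t_]).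
Proof.
have [stop_s|] := boolP (stopped s).
  rewrite word_cons word_cat !word_stopped ?mulr0 ?mul0r //.
  exact: stopped_next.
case: s => i j U V /=; case E: (instr i j) => [[[[] q] p]|] //= _.
  case/lastP: U => [|U k].
    rewrite /= (@word_relator _ _ [::] _ (N5 K E)) /= -catA.
    rewrite (word_cat [:: R_; Q_ q; P_ ord0]) word_slide_right.
    by rewrite -word_cat.
  rewrite word_slide_left last_rcons take_pred_rcons.
  rewrite (@word_relator _ _ (R_ :: map a_ U) _ (N4 K k E)) /= -!catA /=.
  rewrite !(word_cons R_) !(word_cat (map a_ U)) !(word_cons (Q_ q)).
  by rewrite !(word_cons (P_ k)) word_slide_right -catA.
(* A right move leaves the letter before [Q_ i] in place, so it suffices to treat the word from that
   letter on, which is [R_] or the last letter of [U]. *)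
have sub_right Y Z : word K (t_ :: R_ :: Y) = word K (R_ :: Z) ->
    (forall l, word K (t_ :: a_ l :: Y) = word K (a_ l :: Z)) ->
  word K [:: t_, R_ & map a_ U ++ Y] = word K (R_ :: map a_ U ++ Z).
  move=> YR Ya; case/lastP: U => [|U l] //=; rewrite word_slide_left.
  rewrite map_rcons cat_rcons !(word_cons R_) !word_cat; congr (_ * (_ * _)).
  exact: Ya.
rewrite map_rcons cat_rcons -catA /= -catA; apply: sub_right.
  case: V => [|k [|n V]] /=.
  - exact: (@word_relator _ _ [::] [::] (N11 K E)).
  - exact: (@word_relator _ _ [::] [::] (N9 K k E)).
  rewrite (@word_relator _ _ [::] _ (N8 K k n E)) /=.
  rewrite (word_cat [:: R_; a_ p; Q_ q; P_ k]) word_slide_right.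
  by rewrite -word_cat.
move=> l; case: V => [|k [|n V]] /=.
- exact: (@word_relator _ _ [::] [::] (N10 K l E)).
- exact: (@word_relator _ _ [::] [::] (N7 K l k E)).
rewrite (@word_relator _ _ [::] _ (N6 K l k n E)) /=.
rewrite (word_cat [:: a_ l; a_ p; Q_ q; P_ k]) word_slide_right.
by rewrite -word_cat.
Qed.

Lemma word_run_next s n :
  word K (t_ :: run_word s n) = word K (run_word (next s) n ++ [:: t_]).
Proof.
elim: n s => [|n IHn] s //=.
rewrite -cat_cons word_cat word_next -word_cat -!catA word_cat IHn.
by rewrite -word_cat.
Qed.

Lemma word_state_exp s n :
  word K (t_ :: state_word s) ^+ n = word K (run_word (next s) n ++ nseq n t_).
Proof.
elim: n => [|n IHn]; first by rewrite expr0; apply/esym/big_nil.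
(* [state_word s] and [run_word (next s) n] join to [run_word s n.+1], through which the new [t_] is
   pushed at once. *)
rewrite exprS IHn -word_cat /= -cat_cons catA word_cat.
by rewrite (word_run_next s n.+1) -word_cat -catA.
Qed.

Lemma word_run_stopped s k n :
  (k < n)%N -> stopped (iter k next s) -> word K (run_word s n) = 0.
Proof.
elim: n k s => [//|n IHn] [|k] s lt_kn; rewrite /= word_cat.
  by move=> /word_stopped ->; rewrite mul0r.
by rewrite -iterS iterSr => /IHn ->; rewrite ?mulr0.
Qed.

End Algebra.

(** * The action on words without [t] *)

(* [None] is the dead element. *)
Definition lcons (g : gen) (o : option (seq gen)) : option (seq gen) :=
  if o is Some w then
    if (g == Q_ stop_state) && (ohead w == Some (P_ stop_colour)) then None
    else Some (g :: w)
  else None.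
Arguments lcons : simpl never.

Local Notation "g *> o" := (lcons g o) (at level 45, right associativity).

(* [push b w] is [t] applied to [w] if [b = None] and to [x :: w] if
   [b = Some x]: the letter [x] is kept apart because the left moves (N4) and
   (N5) put a new letter in front of the remaining word, which would break the
   structural recursion. *)
Fixpoint push (b : option gen) (w : seq gen) {struct w} : option (seq gen) :=
  match b, w with
  | None, [::] => Some [::]
  | None, x :: w' => push (Some x) w'
  | Some R_, a_ l :: w' => R_ *> push (Some (a_ l)) w'
  | Some (a_ l), R_ :: w' => a_ l *> R_ *> push None w'
  | Some (a_ k), a_ l :: w' => a_ k *> push (Some (a_ l)) w'
  | Some x, Q_ i :: P_ j :: w' =>
      match instr i j, x with
      | Some (Left, q, p), a_ k => Q_ q *> P_ k *> push (Some (a_ p)) w'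
      | Some (Left, q, p), R_ =>
          R_ *> Q_ q *> P_ ord0 *> push (Some (a_ p)) w'
      | Some (Right, q, p), _ =>
          match w' with
          | a_ k :: a_ n :: w'' =>
              x *> a_ p *> Q_ q *> P_ k *> push (Some (a_ n)) w''
          | a_ k :: R_ :: w'' =>
              x *> a_ p *> Q_ q *> P_ k *> R_ *> push None w''
          | R_ :: w'' =>
              x *> a_ p *> Q_ q *> P_ ord0 *> R_ *> push None w''
          | _ => None
          end
      | _, _ => None
      end
  | _, _ => None
  end.

Definition act (g : gen) (o : option (seq gen)) : option (seq gen) :=
  if g is t_ then obind (push None) o else g *> o.

Definition alive (w : seq gen) : bool := isSome (foldr act (Some [::]) w).

Lemma lcons_instr i j w :
  instr i j -> Q_ i *> Some (P_ j :: w) = Some [:: Q_ i, P_ j & w].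
Proof.
rewrite /lcons /=; by case: ifP => // /andP[/eqP[->] /eqP[->]].
Qed.

Lemma alive_relator x y : (forall o, foldr act o x = foldr act o y) ->
  forall u v, alive (u ++ x ++ v) = alive (u ++ y ++ v).
Proof. by move=> xy u v; rewrite /alive !foldr_cat xy. Qed.

Lemma foldr_act_None w : foldr act None w = None.
Proof. by elim: w => //= g w ->; case: g. Qed.

Lemma foldr_act_nseq_t n : foldr act (Some [::]) (nseq n t_) = Some [::].
Proof. by elim: n => //= n ->. Qed.

Lemma foldr_act_a U w :
  foldr act (Some w) (map a_ U) = Some (map a_ U ++ w).
Proof. by elim: U => //= k U ->. Qed.

(** There is no [t_] in the word, so its letters are merely prepended; away from STOP none of them
    kills. *)
Lemma foldr_act_state s w :
  ~~ stopped s -> foldr act (Some w) (state_word s) = Some (state_word s ++ w).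
Proof.
case: s => i j U V /= run_s; rewrite negbK in run_s.
rewrite foldr_cat /= foldr_cat /= foldr_act_a.
rewrite lcons_instr // foldr_act_a.
by rewrite /lcons /= -!catA /= -!catA.
Qed.

Lemma alive_run s n m : ~ halts s -> alive (run_word s n ++ nseq m t_).
Proof.
(* The trailing [t_] act first, and they fix the empty word. *)
move=> run_s; rewrite /alive foldr_cat foldr_act_nseq_t.
suff -> : foldr act (Some [::]) (run_word s n) = Some (run_word s n) by [].
elim: n s run_s => //= n IHn s run_s.
have s_nstop : ~~ stopped s by apply/negP => /halts_stopped.
by rewrite foldr_cat IHn ?foldr_act_state // => /halts_next.
Qed.

(** * A linear functional that vanishes on the ideal *)

Section NonVanishing.
Variable K : fieldType.
Implicit Types (x y z : free_alg K) (u v w : seq gen).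

(** Linear extension of [alive] from words to the free algebra; this functional takes the place of a
    linear representation. *)
Definition alive_coef : free_alg K -> K :=
  mmap idfun (fun m : {fmonom gen} => (alive m)%:R).

Fact alive_coef_zmod_morphism : zmod_morphism alive_coef.
Proof. exact: raddfB. Qed.

HB.instance Definition _ :=
  GRing.isZmodMorphism.Build (free_alg K) K alive_coef alive_coef_zmod_morphism.

Lemma fwordE w : fword K w = << FMonom w >>.
Proof.
elim: w => [|g w IHw]; first by rewrite /fword big_nil -fmoneE.
rewrite /fword big_cons -/(fword K w) IHw /fgen malgM_def fgmulUU mulr1.
by congr << _ >>; rewrite fmuE; apply: fmmulE.
Qed.

Lemma alive_coef_fword w : alive_coef (fword K w) = (alive w)%:R.
Proof. by rewrite fwordE /alive_coef mmapU mul1r. Qed.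

Lemma fword_cat u v : fword K (u ++ v) = fword K u * fword K v.
Proof. exact: big_cat. Qed.

(** Both sides of each of (N1)-(N11) act as the same map, and the word in (N12) sends everything to
    the dead element. *)
Lemma alive_coef_relator x u v :
  relator x -> alive_coef (fword K u * x * fword K v) = 0.
Proof.
have eq_rel l r : (forall o, foldr act o l = foldr act o r) ->
  alive_coef (fword K u * (fword K l - fword K r) * fword K v) = 0.
- move=> /alive_relator lr; rewrite mulrBr mulrBl -!fword_cat.
  by rewrite raddfB /= !alive_coef_fword -!catA lr subrr.
case=> [l|l|k l|k i j q p E|i j q p E|l k n i j q p E|l k i j q p E
  |k n i j q p E|k i j q p E|l i j q p E|i j q p E|].
12: rewrite -!fword_cat alive_coef_fword /alive -catA !foldr_cat /=.
12: by case: (foldr act (Some [::]) v) => [w|] /=; rewrite foldr_act_None.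
all: apply: eq_rel; case=> [w|] //=; rewrite ?[P_ _ *> _]/lcons /=.
all: by rewrite ?lcons_instr ?E //= E.
Qed.

Lemma alive_coefZ c x : alive_coef (c *: x) = c * alive_coef x.
Proof.
rewrite /alive_coef (mmapEw (msuppZ_le _ _)) mmapE big_distrr /=.
by apply: eq_bigr => m _; rewrite mcoeffZ mulrA.
Qed.

Lemma fword_span x : x = \sum_(m <- msupp x) x@_m *: fword K m.
Proof.
rewrite {1}[x]monalgE; apply: eq_bigr => m _.
by apply/malgP => k; rewrite fwordE fmK mcoeffZ !mcoeffU mulrnAr mulr1.
Qed.

(** The factors [y] and [z] stay general in the induction, to absorb the multipliers of the
    ideal. *)
Lemma alive_coef_ideal x y z :
  ideal_gen (@relator K) x -> alive_coef (y * x * z) = 0.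
Proof.
move=> Ix; elim: Ix y z =>
  {x} [x rel_x||x x' _ IHx _ IHx'|u x _ IHx|x v _ IHx] y z.
(* By linearity [z] and then [y] are reduced to words. *)
- rewrite (fword_span z) mulr_sumr raddf_sum big1 // => m _.
  rewrite -malg_scalerAr /= alive_coefZ -mulrA.
  rewrite (fword_span y) mulr_suml raddf_sum big1 ?mulr0 // => m' _.
  by rewrite -scalerAl /= alive_coefZ mulrA alive_coef_relator ?mulr0.
- by rewrite mulr0 mul0r raddf0.
- rewrite (mulrBr y x) (mulrBl z) raddfB /=.
  by rewrite [X in X - _]IHx [X in _ - X]IHx' subrr.
- by rewrite (mulrA y u x) (IHx (y * u) z).
- by rewrite (mulrA y x v) -(mulrA (y * x)) (IHx y (v * z)).
Qed.

Lemma word_alive_neq0 w : alive w -> word K w <> 0.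
Proof.
move=> w_alive; rewrite -pi_fword -(pi_algA0 K) => /pi_algAP /rel_idealP.
rewrite subr0 => /(alive_coef_ideal 1 1) /eqP.
by rewrite mul1r mulr1 alive_coef_fword w_alive oner_eq0.
Qed.

End NonVanishing.

Theorem theorem5p2 (K : fieldType) (i : 'I_7) (j : 'I_4) (U V : seq 'I_4) :
  nilpotent (word K ([:: t_; R_] ++ map a_ U ++ [:: Q_ i; P_ j] ++ map a_ V ++ [:: R_]))
  <-> halts (M i j U V).
Proof.
rewrite -[_ ++ _]/(t_ :: state_word (M i j U V)).
set s := M i j U V; split=> [[n [n_gt0]]|/haltsP[k stop_k]].
  rewrite word_state_exp => nil_n; apply: boolp.contrapT => run_s.
  by apply: (word_alive_neq0 _ nil_n); apply: alive_run => /halts_next.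
(* The product starts at [next s], so its factor of index [k] belongs to [iter k.+1 next s], which
   is still at STOP; reaching index [k] takes [k.+1] factors. *)
exists k.+1; split=> //; rewrite word_state_exp word_cat.
rewrite (@word_run_stopped _ _ k) ?mul0r // -iterSr /=.
exact: stopped_next.
Qed.
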